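(* Let $f(X)=a_{0}+a_{1}X+\cdots +a_{n}X^{n}\in \mathbb{Z}[X]$, $a_{0}a_{n}\neq 0$. Suppose there exist two distinct prime numbers $p$ and $q$ and an index $j\geq 1$ with $j<\frac{n}{\gcd(\nu _{q}(a_{n}),n)}$ such that (i) $\frac{\nu _{p}(a_{0})}{n}>\frac{\nu _{p}(a_{j})}{n-j}$; $\nu _{p}(a_{i}) > \frac{j-i}{j}\, \nu _{p}(a_{0})+\frac{i}{j}\, \nu _{p}(a_{j})$ for $0<i<j$; $\nu _{p}(a_{j})>0$; $\frac{\nu _{p}(a_{i})}{n-i} > \frac{\nu _{p}(a_{j})}{n-j}$ for $j<i<n$; and $\nu _{p}(a_{n}) = 0$; (ii) $\nu _{q}(a_{0})=0$, $\frac{\nu _{q}(a_{i})}{i}\geq \frac{\nu _{q}(a_{n})}{n}$ for all $0<i\le n$, and $\nu _{q}(a_{n})>0$; (iii) $\gcd(\nu _{p}(a_{j}),n-j)=\gcd(\nu _{p}(a_{0})-\nu _{p}(a_{j}),j)=1$. Then $f$ is irreducible over $\mathbb{Q}$.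
   Context: For a prime $p$ and a nonzero integer $m$, $\nu_p(m)$ is the largest integer $i$ such that $p^i\mid m$; by convention $\nu_p(0)=\infty$ (so lower bounds on $\nu_p(a_i)$ hold automatically when $a_i=0$). *)

(* Defs.v *)
From mathcomp Require Import all_boot all_order all_algebra.
From mathcomp Require Import constructive_ereal.
Set Implicit Arguments.
Unset Strict Implicit.
Unset Printing Implicit Defensive.
Import Order.TTheory GRing.Theory Num.Theory.
Local Open Scope ring_scope.

(* Finite p-adic valuation; only meaningful for m != 0 (it is 0 at m = 0). *)
Definition pval (p : nat) (m : int) : nat := logn p `|m|%N.

(* p-adic valuation with the convention that it is +oo at 0. *)
Definition epval (p : nat) (m : int) : \bar rat :=
  if m == 0 then +oo%E else (pval p m)%:R%:E.

(* Main.v *)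
(** The lower Newton polygon of a product is the Minkowski sum of the polygons
    of its factors (Dumas), so each edge of [f = g * r] splits into parallel,
    possibly degenerate, edges of [g] and [r].  At [p], the polygon of [f] has
    the vertices [0], [j] and [n], and by (iii) neither edge carries an interior
    lattice point: hence [deg g] is one of [0], [j], [n - j], [n].  At [q], the
    polygon is a single segment, whose slope makes [deg g] a multiple of
    [n / gcd (nu_q a_n) n > j]; this excludes [j] and [n - j]. *)
Require Import Defs.
From mathcomp Require Import all_boot all_order all_algebra.
From mathcomp Require Import constructive_ereal.
From mathcomp Require Import zify ring.
Import Order.TTheory GRing.Theory Num.Theory.
Local Open Scope ring_scope.

Set Implicit Arguments.
Unset Strict Implicit.
Unset Printing Implicit Defensive.

(** * Valuations of products and finite sums *)

Lemma dvdz_pval (p e : nat) (x : int) :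
  prime p -> x != 0 -> ((p ^ e)%N %| x)%Z = (e <= pval p x)%N.
Proof.
by move=> p_pr x0; rewrite dvdzE pfactor_dvdn // absz_gt0.
Qed.

Lemma pvalM (p : nat) (x y : int) :
  x != 0 -> y != 0 -> pval p (x * y) = (pval p x + pval p y)%N.
Proof. by move=> x0 y0; rewrite /pval abszM lognM // absz_gt0. Qed.

(** Otherwise [p ^ e.+1] would divide every term, hence the sum. The witness must be a nonzero term
    because [pval] takes the default value 0 at 0. *)
Lemma pval_sum_ge (p : nat) (I : finType) (F : I -> int) :
  prime p -> \sum_i F i != 0 ->
  exists2 i, F i != 0 & (pval p (F i) <= pval p (\sum_i F i))%N.
Proof.
move=> p_pr S0; set e := pval p _.
suff /existsP[i /andP[]] : [exists i, (F i != 0) && (pval p (F i) <= e)%N].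
  by exists i.
apply: contraT => /existsPn allF.
suff : ((p ^ e.+1)%N %| \sum_i F i)%Z by rewrite dvdz_pval // ltnn.
apply: rpred_sum => i _; have := allF i.
case: eqVneq => [-> _|Fi0 /=]; first exact: dvdz0.
by rewrite -ltnNge dvdz_pval.
Qed.

(** Modulo [p ^ e.+1], with [e] the valuation of [F i0], only that term survives. *)
Lemma pval_sum_dominant (p : nat) (I : finType) (F : I -> int) (i0 : I) :
  prime p -> F i0 != 0 ->
  (forall i, i != i0 -> F i != 0 -> (pval p (F i0) < pval p (F i))%N) ->
  \sum_i F i != 0 /\ pval p (\sum_i F i) = pval p (F i0).
Proof.
move=> p_pr F0 dom; set e := pval p (F i0).
have rest : ((p ^ e.+1)%N %| \sum_(i | i != i0) F i)%Z.
  apply: rpred_sum => i ii0; case: (eqVneq (F i) 0) => [->|Fi0].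
    exact: dvdz0.
  by rewrite dvdz_pval // dom.
have rest' : ((p ^ e)%N %| \sum_(i | i != i0) F i)%Z.
  by apply: dvdz_trans rest; rewrite dvdzE dvdn_exp2l.
have lt_e : ~~ ((p ^ e.+1)%N %| \sum_i F i)%Z.
  by rewrite (bigD1 i0) //= rpredDr // dvdz_pval // ltnn.
have S0 : \sum_i F i != 0 by apply: contraNneq lt_e => ->; rewrite dvdz0.
split=> //; apply/eqP; rewrite eqn_leq; apply/andP; split.
  by rewrite leqNgt -dvdz_pval.
by rewrite -dvdz_pval // (bigD1 i0) //= rpredDr // dvdz_pval.
Qed.

(** * Newton polygons through their supporting lines *)

(** A linear functional on the points (index, valuation), constant along lines of slope [- B / A]
    and scaled by [A] to stay integral. *)
Definition wt (p A : nat) (B : int) (g : {poly int}) (i : nat) : int :=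
  A%:Z * (pval p g`_i)%:Z + B * i%:Z.

(* [lo, hi] is the span of the indices where the line of slope [- B / A] supports
   the Newton polygon; [lo = hi] when it only touches a vertex. *)
Definition edge (p A : nat) (B : int) (g : {poly int}) (lo hi : nat) : Prop :=
  [/\ g`_lo != 0, g`_hi != 0, wt p A B g lo = wt p A B g hi
    & forall i, g`_i != 0 ->
      wt p A B g lo < wt p A B g i
      \/ wt p A B g i = wt p A B g lo /\ (lo <= i <= hi)%N].

Lemma wt_mul_ge (p A : nat) (B : int) (g r : {poly int}) (m : nat) :
  prime p -> (g * r)`_m != 0 ->
  exists k l, [/\ (k + l)%N = m, g`_k != 0, r`_l != 0
    & wt p A B g k + wt p A B r l <= wt p A B (g * r) m].
Proof.
move=> p_pr; rewrite /wt coefM => /(pval_sum_ge p_pr)[k].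
rewrite mulf_eq0 negb_or => /andP[gk rl].
rewrite pvalM // => le_v; exists k, (m - k)%N.
have km : (k + (m - k) = m)%N by rewrite subnKC // -ltnS.
split=> //; have : B * k%:Z + B * (m - k)%N%:Z = B * m%:Z.
  by rewrite -mulrDr -PoszD km.
have : (A * (pval p g`_k + pval p r`_(m - k))
         <= A * pval p (\sum_(i < m.+1) g`_i * r`_(m - i)))%N.
  by rewrite leq_mul2l le_v orbT.
lia.
Qed.

(** On the antidiagonal [i + m = k + l] the [B] parts agree, so the strictly lightest pair has the
    strictly smallest valuation and dominates the convolution sum. *)
Lemma wt_mul_eq (p A : nat) (B : int) (g r : {poly int}) (k l : nat) :
  prime p -> g`_k != 0 -> r`_l != 0 ->
  (forall i m, (i + m = k + l)%N -> i != k -> g`_i != 0 -> r`_m != 0 ->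
    wt p A B g k + wt p A B r l < wt p A B g i + wt p A B r m) ->
  (g * r)`_(k + l) != 0 /\
  wt p A B (g * r) (k + l) = wt p A B g k + wt p A B r l.
Proof.
move=> p_pr gk rl dom.
have k_lt : (k < (k + l).+1)%N by rewrite ltnS leq_addr.
pose F (i : 'I_(k + l).+1) := g`_i * r`_(k + l - i).
have Fk : F (Ordinal k_lt) = g`_k * r`_l by rewrite /F /= addKn.
have [|i ik|S0 vS] := @pval_sum_dominant p _ F (Ordinal k_lt) p_pr.
- by rewrite Fk mulf_neq0.
- rewrite Fk mulf_eq0 negb_or => /andP[gi rm]; rewrite /F !pvalM //.
  have im : (i + (k + l - i) = k + l)%N by rewrite subnKC // -ltnS.
  have := dom _ _ im ik gi rm; rewrite /wt => lt_w.
  have : B * i%:Z + B * (k + l - i)%N%:Z = B * k%:Z + B * l%:Z.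
    by rewrite -!mulrDr -!PoszD im.
  (* [A] is positive: for [A = 0], [lt_w] would contradict [Beq]. *)
  move=> Beq; rewrite -(ltn_pmul2l (_ : 0 < A)%N); lia.
rewrite /wt coefM -/F; split=> //.
by rewrite -[\sum_i _]/(\sum_i F i) vS Fk pvalM //; lia.
Qed.

(** Any other pair of indices with sum [lg + lr] has one index below its lower end, hence a larger
    weight; likewise at the upper ends. So nothing cancels at either end. *)
Lemma edge_mul (p A : nat) (B : int) (g r : {poly int}) (lg hg lr hr : nat) :
  prime p -> edge p A B g lg hg -> edge p A B r lr hr ->
  edge p A B (g * r) (lg + lr) (hg + hr).
Proof.
move=> p_pr [glo ghi gw gmin] [rlo rhi rw rmin].
have [|flo wlo] := @wt_mul_eq p A B g r lg lr p_pr glo rlo.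
  by move=> i m im /eqP ik /gmin gi /rmin rm; lia.
have [|fhi whi] := @wt_mul_eq p A B g r hg hr p_pr ghi rhi.
  by move=> i m im /eqP ik /gmin gi /rmin rm; lia.
split=> //; first by rewrite wlo whi; lia.
move=> i /(wt_mul_ge A B p_pr)[k [l [kl /gmin gk /rmin rl le_w]]].
rewrite wlo; lia.
Qed.

Lemma edge_uniq (p A : nat) (B : int) (g : {poly int}) (lo hi lo' hi' : nat) :
  edge p A B g lo hi -> edge p A B g lo' hi' -> lo = lo' /\ hi = hi'.
Proof.
move=> [l0 h0 w m] [l0' h0' w' m'].
have := m _ l0'; have := m _ h0'; have := m' _ l0; have := m' _ h0.
lia.
Qed.

Lemma edge_exists (p A : nat) (B : int) (g : {poly int}) :
  g != 0 -> exists lo hi, edge p A B g lo hi.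
Proof.
move=> g0; have sz i : g`_i != 0 -> (i < size g)%N.
  by apply: contraNT; rewrite -leqNgt => /leq_sizeP ->.
have k0P : g`_((size g).-1) != 0 by rewrite -[_`_ _]/(lead_coef g) lead_coef_eq0.
pose k0 := Ordinal (sz _ k0P).
pose k := [arg min_(i < k0 | g`_(i : 'I_(size g)) != 0) wt p A B g i]%O.
have [gk kmin] : g`_k != 0 /\
    forall i, g`_i != 0 -> wt p A B g k <= wt p A B g i.
  rewrite /k; case: arg_minP => //= i gi imin; split=> // i' gi'.
  exact: (imin (Ordinal (sz _ gi'))).
pose P i := (g`_i != 0) && (wt p A B g i == wt p A B g k).
have Pk : exists i, P i by exists k; rewrite /P gk eqxx.
have Pb i : P i -> (i <= size g)%N by case/andP => /sz/ltnW.
have [lo /andP[lo0 /eqP low] lomin] := ex_minnP Pk.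
have [hi /andP[hi0 /eqP hiw] himax] := ex_maxnP Pk Pb.
exists lo, hi; split; rewrite ?low ?hiw // => i gi.
have := kmin i gi; rewrite le_eqVlt => /orP[/eqP e|]; [right|by left].
have Pi : P i by rewrite /P gi e eqxx.
by rewrite lomin // himax.
Qed.

(** The edges of [g] and [r] for this slope add up to an edge of the product, which is unique. *)
Lemma edge_split (p A : nat) (B : int) (g r : {poly int}) (lo hi : nat) :
  prime p -> edge p A B (g * r) lo hi ->
  exists lg hg lr hr, [/\ edge p A B g lg hg, edge p A B r lr hr,
    (lg + lr = lo)%N & (hg + hr = hi)%N].
Proof.
move=> p_pr E; have f0 : g * r != 0.
  by case: E => flo _ _ _; apply: contraNneq flo => ->; rewrite coef0.
move: (f0); rewrite mulf_eq0 negb_or => /andP[g0 r0].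
have [lg [hg Eg]] := edge_exists p A B g0.
have [lr [hr Er]] := edge_exists p A B r0.
have [] := edge_uniq (edge_mul p_pr Eg Er) E.
by exists lg, hg, lr, hr.
Qed.

Lemma edge_le (p A : nat) (B : int) (g : {poly int}) (lo hi : nat) :
  edge p A B g lo hi -> (lo <= hi)%N.
Proof. by case=> l0 h0 w /(_ _ h0); lia. Qed.

Lemma edge_lt_size (p A : nat) (B : int) (g : {poly int}) (lo hi : nat) :
  edge p A B g lo hi -> (hi < size g)%N.
Proof.
by case=> _ + _ _; apply: contraNT; rewrite -leqNgt => /leq_sizeP ->.
Qed.

Lemma dvdz_edge (p A : nat) (B : int) (g : {poly int}) (lo hi : nat) :
  edge p A B g lo hi -> (A %| B * (hi%:Z - lo%:Z))%Z.
Proof.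
case=> _ _; rewrite /wt => w _; apply/dvdzP.
by exists ((pval p g`_lo)%:Z - (pval p g`_hi)%:Z); lia.
Qed.

(** Valuations at the two ends are integers, so [A] divides [B * (hi - lo)]. Consequently an edge of
    width [A] goes entirely to one of two factors. *)
Lemma edge_dvdn (p A : nat) (B : int) (g : {poly int}) (lo hi : nat) :
  coprimez A B -> edge p A B g lo hi -> (A %| hi - lo)%N.
Proof.
move=> cop E; have := dvdz_edge E.
by rewrite Gauss_dvdzr // subzn ?(edge_le E).
Qed.

(* Convexity: the edge of steeper slope lies to the left. *)
Lemma edge_mono (p A A' : nat) (B B' : int) (g : {poly int})
    (lo hi lo' hi' : nat) :
  B' * A%:Z < B * A'%:Z ->
  edge p A B g lo hi -> edge p A' B' g lo' hi' -> (hi <= lo')%N.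
Proof.
move=> ltB [_ h0 w m] [l0' _ _ m'].
have {m} := m _ l0'; have {m'} := m' _ h0; rewrite w /wt => E1 E2.
rewrite leqNgt; apply/negP => lt_i.
set x := pval p g`_hi in E1 E2; set y := pval p g`_lo' in E1 E2.
have {}E1 : A'%:Z * y%:Z + B' * lo'%:Z <= A'%:Z * x%:Z + B' * hi%:Z by lia.
have {}E2 : A%:Z * x%:Z + B * hi%:Z <= A%:Z * y%:Z + B * lo'%:Z by lia.
(* Adding [H1] and [H2] cancels [x] and [y] and leaves [(B * A' - B' * A) * (hi - lo') <= 0],
   against [H3]. *)
have H1 : 0 <= A%:Z * (A'%:Z * x%:Z + B' * hi%:Z - A'%:Z * y%:Z - B' * lo'%:Z).
  by apply: mulr_ge0 => //; lia.
have H2 : 0 <= A'%:Z * (A%:Z * y%:Z + B * lo'%:Z - A%:Z * x%:Z - B * hi%:Z).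
  by apply: mulr_ge0 => //; lia.
have H3 : 0 < (B * A'%:Z - B' * A%:Z) * (hi%:Z - lo'%:Z) by apply: mulr_gt0; lia.
lia.
Qed.

(** * Possible degrees of a factor *)

Lemma edges_factor_size (p q n j : nat) (u v : int) (V : nat)
    (g r : {poly int}) :
  prime p -> prime q -> (0 < j < n)%N -> (j * gcdn V n < n)%N ->
  size (g * r) = n.+1 -> v * j%:Z < u * (n - j)%N%:Z ->
  coprimez j u -> coprimez (n - j)%N v ->
  edge p j u (g * r) 0 j -> edge p (n - j) v (g * r) j n ->
  edge q n (- V%:Z) (g * r) 0 n ->
  size g = 1%N \/ size g = n.+1.
Proof.
move=> p_pr q_pr /andP[j0 jn] jV sz_gr slope cop1 cop2 E1 E2 E3.
have : g * r != 0 by rewrite -size_poly_gt0 sz_gr.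
rewrite mulf_eq0 negb_or => /andP[g0 r0].
have [l1 [h1 [l1' [h1' [G1 R1 eq0 eq1]]]]] := edge_split p_pr E1.
have [l2 [h2 [l2' [h2' [G2 R2 eq2 eq2']]]]] := edge_split p_pr E2.
have [l3 [h3 [l3' [h3' [G3 R3 eq3 eq3']]]]] := edge_split q_pr E3.
(* Since [h1 + h1' = l2 + l2' = j], these inequalities are equalities: the two edges meet in each
   factor. The size bounds likewise force [h2] and [h3] to be the degree of [g]. *)
have := edge_mono slope G1 G2; have := edge_mono slope R1 R2.
move=> le_r le_g.
have := edge_lt_size G2; have := edge_lt_size R2.
have := edge_lt_size G3; have := edge_lt_size R3.
move: sz_gr; rewrite size_mul //.
move: (size g) (size r) => sg sr sz_gr lt1 lt2 lt3 lt4.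
have := edge_le G1; have := edge_le G2; have := edge_le R2; have := edge_le R1.
have := edge_dvdn cop1 G1; have := edge_dvdn cop2 G2.
have -> : (h1 - l1 = h1)%N by lia.
move=> /dvdnP[x dx] /dvdnP[y dy] le1 le2 le3 le4.
have := dvdz_edge G3.
rewrite mulNr rpredN; have -> : h3%:Z - l3%:Z = sg.-1%:Z by lia.
rewrite -PoszM dvdzE !absz_nat => dvd_V.
(* Otherwise [n] divides [gcdn V n * j], which is positive and less than [n]. *)
have not_dvd : ~~ (n %| V * j)%N.
  apply/negP => dvd_j; have : (n %| gcdn V n * j)%N.
    by rewrite muln_gcdl dvdn_gcd dvd_j dvdn_mulr.
  by move=> /dvdn_leq; rewrite muln_gt0 gcdn_gt0; lia.
have x_le1 : (x <= 1)%N.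
  by rewrite -(@leq_pmul2r (n - j)) ?subn_gt0 // -dx; lia.
have y_le1 : (y <= 1)%N by rewrite -(@leq_pmul2r j) // -dy; lia.
(* The degree of [g] is [x * (n - j) + y * j], with [x] and [y] at most 1. *)
case: x x_le1 dx => [|[|//]] _ dx; case: y y_le1 dy => [|[|//]] _ dy;
  [left; lia| | |right; lia].
- by case/negP: not_dvd; have <- : sg.-1 = j by lia.
- case/negP: not_dvd; have sgE : sg.-1 = (n - j)%N by lia.
  have -> : (V * j = V * n - V * sg.-1)%N.
    by rewrite -mulnBr sgE subKn // ltnW.
  by rewrite dvdn_sub // dvdn_mull.
Qed.

(** * Descent from rational to integer factors *)

(** By Gauss's lemma a rational divisor is a scalar multiple of an integral one, so controlling
    sizes over the integers suffices. *)
Lemma irreducible_rat_int (f : {poly int}) :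
  (1 < size f)%N ->
  (forall g r : {poly int}, f = g * r -> size g = 1%N \/ size g = size f) ->
  irreducible_poly (map_poly intr f : {poly rat}).
Proof.
have sz (h : {poly int}) : size (map_poly intr h : {poly rat}) = size h.
  by apply: size_map_inj_poly => //; exact: intr_inj.
move=> sf fac; split; first by rewrite sz.
move=> g sg dvd_g; rewrite -dvdp_size_eqp // sz.
have [g' [c c0 gE] [r fE]] := dvdpP_rat_int dvd_g.
move: sg; rewrite gE size_scale // sz.
by case: (fac _ _ fE) => ->.
Qed.

(** * From extended valuations to integer inequalities *)

Lemma epval_neq0 (p : nat) (m : int) :
  m != 0 -> epval p m = (pval p m)%:R%:E.
Proof. by rewrite /epval => /negbTE ->. Qed.

Lemma epval_slopeE (p : nat) (m : int) (k : nat) :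
  m != 0 -> (0 < k)%N ->
  (epval p m / k%:R%:E = ((pval p m)%:R / k%:R)%:E)%E.
Proof.
by move=> m0 k0; rewrite epval_neq0 // inver pnatr_eq0 -[k == _]negbK -lt0n k0.
Qed.

Lemma ltr_nat_div (F : numFieldType) (x y k l : nat) :
  (0 < k)%N -> (0 < l)%N ->
  (x%:R / k%:R < y%:R / l%:R :> F) = (x * l < y * k)%N.
Proof.
move=> k0 l0; rewrite ltr_pdivrMr ?ltr0n // mulrAC ltr_pdivlMr ?ltr0n //.
by rewrite -!natrM ltr_nat.
Qed.

Lemma ler_nat_div (F : numFieldType) (x y k l : nat) :
  (0 < k)%N -> (0 < l)%N ->
  (x%:R / k%:R <= y%:R / l%:R :> F) = (x * l <= y * k)%N.
Proof.
move=> k0 l0; rewrite ler_pdivrMr ?ltr0n // mulrAC ler_pdivlMr ?ltr0n //.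
by rewrite -!natrM ler_nat.
Qed.

(** For [x = 0] the left side is [+oo], which is not below a finite value. *)
Lemma epval_slope_lt (p : nat) (x y : int) (k l : nat) :
  (0 < k)%N -> (0 < l)%N -> y != 0 ->
  (epval p x / k%:R%:E < epval p y / l%:R%:E)%E ->
  x != 0 /\ (pval p x * l < pval p y * k)%N.
Proof.
move=> k0 l0 y0; rewrite (epval_slopeE p y0 l0).
case: (eqVneq x 0) => [->|x0].
  rewrite /epval eqxx inver pnatr_eq0 -[k == _]negbK -lt0n k0 /=.
  by rewrite gt0_mulye // lte_fin invr_gt0 ltr0n.
by rewrite (epval_slopeE p x0 k0) lte_fin ltr_nat_div.
Qed.

Theorem theorem1p21 (n : nat) (a : nat -> int) (f : {poly int})
  (f_def : f = \poly_(i < n.+1) a i)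
  (a0an_neq0 : a 0%N * a n != 0)
  (p q : nat) (p_prime : prime p) (q_prime : prime q) (p_neq_q : p != q)
  (j : nat) (j_ge1 : (1 <= j)%N)
  (j_lt : (j%:R : rat) < n%:R / (gcdn (pval q (a n)) n)%:R)
  (* (i) *)
  (p_slopes : (epval p (a j) / (n%:R - j%:R)%:E < epval p (a 0%N) / n%:R%:E)%E)
  (p_left : forall i : nat, (0 < i < j)%N ->
    (((j%:R - i%:R) / j%:R)%:E * epval p (a 0%N)
       + (i%:R / j%:R)%:E * epval p (a j) < epval p (a i))%E)
  (p_aj : (0 < epval p (a j))%E)
  (p_right : forall i : nat, (j < i < n)%N ->
    (epval p (a j) / (n%:R - j%:R)%:E < epval p (a i) / (n%:R - i%:R)%:E)%E)
  (p_an : epval p (a n) = 0%E)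
  (* (ii) *)
  (q_a0 : epval q (a 0%N) = 0%E)
  (q_slope : forall i : nat, (0 < i <= n)%N ->
    (epval q (a n) / n%:R%:E <= epval q (a i) / i%:R%:E)%E)
  (q_an : (0 < epval q (a n))%E)
  (* (iii); a j != 0 by p_slopes *)
  (gcd_right : gcdz (pval p (a j))%:Z (n%:Z - j%:Z) = 1)
  (gcd_left : gcdz ((pval p (a 0%N))%:Z - (pval p (a j))%:Z) j%:Z = 1) :
  irreducible_poly (map_poly intr f : {poly rat}).
Proof.
have /andP[a0 an] : (a 0%N != 0) && (a n != 0).
  by rewrite -negb_or -mulf_eq0.
have n0 : (0 < n)%N.
  by rewrite lt0n; apply: contraTneq j_lt => ->; rewrite mul0r -leNgt ler0n.
have jV : (j * gcdn (pval q (a n)) n < n)%N.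
  have d0 : (0 < gcdn (pval q (a n)) n)%N by rewrite gcdn_gt0 n0 orbT.
  by move: j_lt; rewrite ltr_pdivlMr ?ltr0n // -natrM ltr_nat.
have jn : (j < n)%N.
  by apply: leq_ltn_trans jV; rewrite leq_pmulr // gcdn_gt0 n0 orbT.
have nj0 : (0 < n - j)%N by rewrite subn_gt0.
have coef_f i : f`_i != 0 -> (i <= n)%N /\ f`_i = a i.
  by rewrite f_def coef_poly ltnS; case: ifP => //; rewrite eqxx.
have coef_le i : (i <= n)%N -> f`_i = a i.
  by rewrite f_def coef_poly ltnS => ->.
have size_f : size f = n.+1 by rewrite f_def size_poly_eq.
move: p_slopes; rewrite -natrB ?(ltnW jn) // => /(epval_slope_lt nj0 n0 a0)[aj slopes].
have vn : pval p (a n) = 0%N.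
  by move: p_an; rewrite epval_neq0 // => -[/eqP]; rewrite pnatr_eq0 => /eqP.
have v0q : pval q (a 0%N) = 0%N.
  by move: q_a0; rewrite epval_neq0 // => -[/eqP]; rewrite pnatr_eq0 => /eqP.
set v0 := pval p (a 0%N) in gcd_left slopes *.
set vj := pval p (a j) in gcd_left gcd_right slopes *.
(* Strict convexity at the vertex [j]: this quantity equals [(v0 - vj) * (n - j) - vj * j], which
   compares the two slopes. *)
have zslopes : 0 < v0%:Z * (n%:Z - j%:Z) - vj%:Z * n%:Z.
  by rewrite subr_gt0 subzn ?(ltnW jn) // -!PoszM ltz_nat.
have left_gt i : (0 < i < j)%N -> a i != 0 ->
    (j%:Z - i%:Z) * v0%:Z + i%:Z * vj%:Z < j%:Z * (pval p (a i))%:Z.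
  move=> ij ai; have /andP[_ i_j] := ij; have := p_left i ij.
  rewrite !epval_neq0 // -!EFinM -EFinD lte_fin -natrB ?(ltnW i_j) //.
  rewrite mulrAC [X in _ + X]mulrAC -mulrDl ltr_pdivrMr ?ltr0n //.
  rewrite -!natrM -natrD ltr_nat [(_ * j)%N]mulnC.
  by rewrite subzn ?(ltnW i_j) // -!PoszM -PoszD ltz_nat.
have left_ge i : (i < j)%N -> a i != 0 ->
    (j%:Z - i%:Z) * v0%:Z + i%:Z * vj%:Z <= j%:Z * (pval p (a i))%:Z.
  case: i => [_ _|i ij ai]; first by rewrite -/v0; lia.
  exact/ltW/left_gt.
have right_gt i : (j < i < n)%N -> a i != 0 ->
    vj%:Z * (n%:Z - i%:Z) < (pval p (a i))%:Z * (n%:Z - j%:Z).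
  move=> ij ai; have /andP[_ i_n] := ij; have := p_right i ij.
  rewrite -!natrB ?(ltnW jn) ?(ltnW i_n) // => /epval_slope_lt.
  rewrite !subn_gt0 => /(_ jn i_n ai)[_].
  by rewrite !subzn ?(ltnW jn) ?(ltnW i_n) // -!PoszM ltz_nat.
(* The added index [i = n] gives equality, as does [i = 0] in [left_ge]. *)
have right_ge i : (j < i <= n)%N -> a i != 0 ->
    vj%:Z * (n%:Z - i%:Z) <= (pval p (a i))%:Z * (n%:Z - j%:Z).
  move=> /andP[ji]; rewrite leq_eqVlt => /orP[/eqP -> _|i_n ai].
    by rewrite vn; lia.
  by apply/ltW/right_gt; rewrite ?ji.
set V := pval q (a n) in jV.
have q_ge i : (0 < i <= n)%N -> a i != 0 -> (V * i <= pval q (a i) * n)%N.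
  move=> /[dup] i_n /andP[i0 _] ai; have := q_slope i i_n.
  by rewrite !epval_slopeE // lee_fin ler_nat_div.
have E1 : edge p j (v0%:Z - vj%:Z) f 0 j.
  rewrite /edge /wt !coef_le ?(ltnW jn) // -/v0 -/vj; split=> //; first by lia.
  move=> i /[dup] fi0 /coef_f[i_n fi]; rewrite fi in fi0 *.
  case: (ltngtP i j) => [ij|ji|->]; last by right; split; lia.
    case: (posnP i) => [->|i0]; first by right; rewrite -/v0; split; lia.
    by left; have := left_gt i; rewrite i0 ij => /(_ isT fi0); lia.
  left; have := right_ge i; rewrite ji i_n => /(_ isT fi0); rewrite -subr_ge0.
  set t := pval p (a i) => le_t.
  (* Scaled by [n - j], the excess over the left edge is [j] times the excess over the right edge,
     plus [i - j] times the positive gap in [zslopes]. *)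
  rewrite -subr_gt0 -(@pmulr_rgt0 _ (n%:Z - j%:Z)); last by lia.
  have -> : (n%:Z - j%:Z) * (j%:Z * t%:Z + (v0%:Z - vj%:Z) * i%:Z
      - (j%:Z * v0%:Z + (v0%:Z - vj%:Z) * 0%N%:Z)) =
    j%:Z * (t%:Z * (n%:Z - j%:Z) - vj%:Z * (n%:Z - i%:Z)) +
    (i%:Z - j%:Z) * (v0%:Z * (n%:Z - j%:Z) - vj%:Z * n%:Z) by ring.
  by rewrite ltr_wpDl ?mulr_ge0 // mulr_gt0 //; lia.
have E2 : edge p (n - j) vj%:Z f j n.
  rewrite /edge /wt !coef_le ?(ltnW jn) // vn -/vj -subzn ?(ltnW jn) //.
  split=> //; first by lia.
  move=> i /[dup] fi0 /coef_f[i_n fi]; rewrite fi in fi0 *.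
  case: (ltngtP i j) => [ij|ji|->]; last by right; rewrite -/vj; split; lia.
    left; have := left_ge i ij fi0; rewrite -subr_ge0.
    set t := pval p (a i) => le_t.
    (* The mirror image: scaling by [j] reduces to the excess over the left edge and the same
       gap. *)
    rewrite -subr_gt0 -(@pmulr_rgt0 _ j%:Z); last by lia.
    have -> : j%:Z * ((n%:Z - j%:Z) * t%:Z + vj%:Z * i%:Z
        - ((n%:Z - j%:Z) * vj%:Z + vj%:Z * j%:Z)) =
      (n%:Z - j%:Z) * (j%:Z * t%:Z - ((j%:Z - i%:Z) * v0%:Z + i%:Z * vj%:Z)) +
      (j%:Z - i%:Z) * (v0%:Z * (n%:Z - j%:Z) - vj%:Z * n%:Z) by ring.
    rewrite ltr_wpDl //; first by rewrite mulr_ge0 //; lia.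
    by rewrite mulr_gt0 //; lia.
  move: i_n; rewrite leq_eqVlt => /orP[/eqP ->|i_n].
    by right; rewrite vn; split; lia.
  by left; have := right_gt i; rewrite ji i_n => /(_ isT fi0); lia.
(* Condition (ii) is not strict: interior points may lie on this segment, as [edge] permits. *)
have E3 : edge q n (- V%:Z) f 0 n.
  rewrite /edge /wt !coef_le // v0q -/V; split=> //; first by lia.
  move=> i /[dup] fi0 /coef_f[i_n fi]; rewrite fi in fi0 *.
  have : (V * i <= pval q (a i) * n)%N.
    case: (posnP i) => [->|i0]; first by rewrite muln0.
    by apply: q_ge; rewrite ?i0.
  rewrite -lez_nat !PoszM; lia.
apply: irreducible_rat_int; rewrite size_f // => g r fE.
rewrite fE in size_f E1 E2 E3.
apply: (edges_factor_size p_prime q_prime _ jV size_f _ _ _ E1 E2 E3).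
- exact/andP.
- by rewrite -subzn ?(ltnW jn) //; lia.
- by apply/eqP; rewrite gcdzC.
- by apply/eqP; rewrite gcdzC -subzn ?(ltnW jn).
Qed.
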